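(* Let $d\ge1$ and $n\in\mathbb{N}$. For all $M\in\mathbb{C}^{d\times d}$ we have $M^{n\otimes}x\in X_n$ whenever $x\in X_n$.
   Context: $\mathbb{N}=\{0,1,2,\ldots\}$. Let $\nu_n=(\nu_n(1),\ldots,\nu_n(d^n))$ be the redundant list of multi-indices in $\mathbb{N}^d$ of modulus $n$ (i.e. with entries summing to $n$) defined recursively by $\nu_0=((0,\ldots,0))$ and $\nu_{n+1}((m-1)d^n+j)=\nu_n(j)+e_m^t$ for $m=1,\ldots,d$, $j=1,\ldots,d^n$, where $e_m$ is the $m$th standard basis vector of $\mathbb{C}^d$. The $n$th symmetric subspace is \[X_n=\{x\in\mathbb{C}^{d^n}:\ x_j=x_{j'}\text{ for all }j,j'\in\{1,\ldots,d^n\}\text{ with }\nu_n(j)=\nu_n(j')\}.\] $M^{n\otimes}=M\otimes\cdots\otimes M$ ($n$ factors, usual Kronecker product, so $M^{(n+1)\otimes}$ is the block matrix with blocks $M_{ij}M^{n\otimes}$; $M^{0\otimes}=1$). *)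

(* Defs.v *)
From mathcomp Require Import all_boot all_order all_algebra.
From mathcomp Require Import all_classical all_reals.
From mathcomp Require Export complex mxtens.

Set Implicit Arguments.
Unset Strict Implicit.
Unset Printing Implicit Defensive.

Import GRing.Theory.
Local Open Scope ring_scope.
Local Open Scope classical_set_scope.

(* Positions and coordinates are counted from 0: [mxtens_unindex] sends the
   position m * d ^ n + j, with j < d ^ n, to the pair (m, j).  This is also the
   block ordering used by the Kronecker product [*t]. *)
Fixpoint nu (d n : nat) : 'I_(d ^ n) -> 'rV[nat]_d :=
  if n is n'.+1 return 'I_(d ^ n) -> 'rV[nat]_d then
    fun k => let: (m, j) := mxtens_unindex (cast_ord (expnS d n') k) in
             nu j + delta_mx 0 m
  else fun=> 0.

Lemma nuS (d n : nat) (m : 'I_d) (j : 'I_(d ^ n)) :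
  @nu d n.+1 (cast_ord (esym (expnS d n)) (mxtens_index (m, j)))
  = nu j + delta_mx 0 m.
Proof.
have nuE k : @nu d n.+1 k =
    let: (m, j) := mxtens_unindex (cast_ord (expnS d n) k) in
    nu j + delta_mx 0 m by [].
by rewrite nuE cast_ordKV mxtens_indexK.
Qed.

Definition symspace (R : realType) (d n : nat) : set 'cV[R[i]]_(d ^ n) :=
  [set x : 'cV[R[i]]_(d ^ n) |
    forall j j' : 'I_(d ^ n), nu j = nu j' -> x j 0 = x j' 0].

Arguments symspace : clear implicits.

(* Main.v *)
Require Import Defs.
From mathcomp Require Import all_boot all_order all_algebra.
From mathcomp Require Import all_classical all_reals.
From mathcomp Require Import -(notations) mpoly.
Import GRing.Theory.
Local Open Scope ring_scope.

(** Symmetric tensors of order n are the dual of homogeneous polynomials of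
    degree n, and M acts on the latter by a linear substitution of variables.
    Concretely, if v_1, ..., v_d are elements of a commutative algebra, let
    P_k(v) be the product of the powers of the v_m with exponents nu(k); this is
    the k-th coordinate of the n-th tensor power of v.  The mixed product rule
    gives M^{n (x)} P(v) = P(M v) ([ntensmx_mul_powers]).  Take for v the
    variables X_1, ..., X_d: row k of M^{n (x)} is then read off the
    polynomial P_k(M X), which depends on k only through nu(k).  The coefficient
    of X^a in it is the sum of the entries of row k over the class of all j with
    nu(j) = a, so rows k and k' with nu(k) = nu(k') have the same class sums
    ([sum_ntensmx_class]).  An x in the symmetric subspace is constant on the
    classes, hence the coordinates k and k' of M^{n (x)} x, which are the
    pairings of x with these two rows, agree ([eq_sum_class]). *)

Definition tensS_index {d n : nat} (mk : 'I_d * 'I_(d ^ n)) : 'I_(d ^ n.+1) :=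
  cast_ord (esym (expnS d n)) (mxtens_index mk).

Lemma tensS_index_bij (d n : nat) : bijective (@tensS_index d n).
Proof.
exists (fun k => mxtens_unindex (cast_ord (expnS d n) k)) => k.
  by rewrite /tensS_index cast_ordKV mxtens_indexK.
by rewrite /tensS_index mxtens_unindexK cast_ordK.
Qed.

Lemma ntensmxSE (R : pzRingType) (d n : nat) (M : 'M[R]_d)
    (m m' : 'I_d) (k j : 'I_(d ^ n)) :
  (M ^t n.+1) (tensS_index (m, k)) (tensS_index (m', j))
  = M m m' * (M ^t n) k j.
Proof.
case: n k j => [|n] k j.
  (* The first power is M itself, not the product of M with the 1 x 1 identity,
     so the two indices are compared through their values. *)
  rewrite ntensmx1 ntensmx0 [k]ord1 [j]ord1 mxE mulr1.
  by congr (M _ _); apply: val_inj; rewrite /= muln1 addn0.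
have castE (p : 'I_d * 'I_(d ^ n.+1)) : tensS_index p = mxtens_index p.
  exact: val_inj.
by rewrite !castE ntensmxSS tensmxE.
Qed.

Lemma prod_exp_nuS (A : comPzRingType) (d n : nat) (v : 'I_d -> A)
    (m : 'I_d) (k : 'I_(d ^ n)) :
  \prod_i v i ^+ nu (n := n.+1) (tensS_index (m, k)) 0 i
  = v m * \prod_i v i ^+ nu k 0 i.
Proof.
rewrite /tensS_index nuS mulrC.
under eq_bigr => i _ do rewrite !mxE exprD.
rewrite big_split /=; congr (_ * _).
rewrite (bigD1 m) //= eqxx expr1 big1 ?mulr1 // => i /negPf ne_im.
by rewrite ne_im expr0.
Qed.

(** The mixed product rule for the tensor power of a vector: the n-th tensor
    power of M maps the n-th tensor power of v to that of M v. *)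
Lemma ntensmx_mul_powers (R : comNzRingType) (A : comAlgType R) (d n : nat)
    (M : 'M[R]_d) (v : 'I_d -> A) (k : 'I_(d ^ n)) :
  \sum_j (M ^t n) k j *: \prod_i v i ^+ nu j 0 i
  = \prod_i (\sum_m M i m *: v m) ^+ nu k 0 i.
Proof.
elim: n k => [|n IHn] k.
  rewrite ntensmx0 big_ord1 [k]ord1 mxE scale1r.
  by rewrite !big1 // => i _; rewrite mxE expr0.
have [unindex _ indexK] := tensS_index_bij d n.
rewrite -(indexK k); case: (unindex k) => m {}k.
rewrite prod_exp_nuS -IHn (reindex _ (onW_bij _ (tensS_index_bij d n))) /=.
rewrite mulr_suml; under [RHS]eq_bigr => m' _ do rewrite mulr_sumr.
rewrite pair_big; apply: eq_bigr => -[m' j] _ /=.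
by rewrite ntensmxSE prod_exp_nuS -scalerAl -scalerAr scalerA.
Qed.

(** Both sums are the coefficient of the monomial with exponent a in a polynomial
    that is determined by nu. *)
Lemma sum_ntensmx_class (R : comNzRingType) (d n : nat) (M : 'M[R]_d)
    (k k' : 'I_(d ^ n)) (a : 'rV[nat]_d) :
  nu k = nu k' ->
  \sum_(j | nu j == a) (M ^t n) k j = \sum_(j | nu j == a) (M ^t n) k' j.
Proof.
pose X (m : 'I_d) : mpoly d R := mpolyX R (mnm1 m).
pose mon (b : 'rV[nat]_d) : multinom d := Multinom [tuple b 0 i | i < d].
have mon_inj : injective mon.
  by move=> b c /mnmP bc; apply/rowP => i; have := bc i; rewrite !mnmE.
have coefE i : \sum_(j | nu j == a) (M ^t n) i j =
    mcoeff (mon a) (\prod_l (\sum_m M l m *: X m) ^+ nu i 0 l).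
  rewrite -ntensmx_mul_powers raddf_sum big_mkcond /=.
  apply: eq_bigr => j _; rewrite mcoeffZ.
  have -> : \prod_l X l ^+ nu j 0 l = mpolyX R (mon (nu j)).
    by rewrite mpolyXE_id; apply: eq_bigr => l _; rewrite mnmE.
  by rewrite mcoeffX (inj_eq mon_inj); case: eqP; rewrite ?mulr1 ?mulr0.
by move=> eq_nu; rewrite !coefE eq_nu.
Qed.

(** Grouping the terms by classes, x factors out of each group. *)
Lemma eq_sum_class (R : pzRingType) (I : finType) (T : eqType) (c : I -> T)
    (w w' x : I -> R) :
  (forall a, \sum_(j | c j == a) w j = \sum_(j | c j == a) w' j) ->
  (forall j j', c j = c j' -> x j = x j') ->
  \sum_j w j * x j = \sum_j w' j * x j.
Proof.
move=> eq_w x_const.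
(* r i is a chosen representative of the class of i. *)
pose r i := choose (fun j => c j == c i) i.
have c_r i : c (r i) = c i by apply/eqP/(@chooseP _ (fun j => c j == c i)).
have r_c i j : (r j == r i) = (c j == c i).
  apply/eqP/eqP => [eq_r|eq_c]; first by rewrite -c_r eq_r c_r.
  rewrite /r eq_c; apply: (@choose_id _ (fun l => c l == c i)) => //.
  exact/eqP.
have group u : \sum_j u j * x j
    = \sum_(i | i \in codom r) (\sum_(j | c j == c i) u j) * x i.
  rewrite (partition_big r (mem (codom r))) /= => [|j _]; last exact: codom_f.
  apply: eq_bigr => _ /codomP[i ->]; rewrite mulr_suml c_r.
  apply: eq_big => [j|j]; first exact: r_c.
  by rewrite r_c => /eqP cj; rewrite (x_const j (r i)) // c_r.
by rewrite !group; apply: eq_bigr => i _; rewrite eq_w.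
Qed.

Theorem lemma4 (R : realType) (d n : nat) (hd : (1 <= d)%N)
    (M : 'M[R[i]]_d) (x : 'cV[R[i]]_(d ^ n)) :
  x \in symspace R d n -> M ^t n *m x \in symspace R d n.
Proof.
move=> /set_mem x_sym; apply/mem_set => k k' eq_nu; rewrite !mxE.
apply: (eq_sum_class _ _ _ (@nu d n)) => // a.
exact: sum_ntensmx_class.
Qed.
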